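(* Let $(\phi_k)_{k \in \mathbb N}$ be a strictly increasing sequence of positive real numbers such that $\lim_{k \to \infty}\phi_k/\phi_{k+1}=0$, and let $\phi=\{\phi_k \mid k \in \mathbb N\}$ be the set of its terms. Let $m$ be a positive integer, $(a_1,\ldots,a_m)$ a sequence of real numbers of length $m$, and $R$ a positive real number. Let $v:\mathbb R^m \to \mathbb R$ be the linear map $v(x_1,\ldots,x_m)=\sum_{i=1}^m a_i x_i$. Then the set $$\mathfrak I((a_1,\ldots,a_m),R)=v(\phi^m)\cap(-R,R)$$ is finite.
   Context: Here $\phi^m$ denotes the $m$-fold Cartesian power of the set $\phi \subseteq \mathbb R$. *)

(* Defs.v *)
From HB Require Import structures.
From mathcomp Require Import all_boot all_order all_algebra.
From mathcomp Require Import all_classical all_reals all_analysis.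
Import Order.TTheory GRing.Theory Num.Theory.
Import numFieldNormedType.Exports.

Set Implicit Arguments.
Unset Strict Implicit.
Unset Printing Implicit Defensive.

Local Open Scope classical_set_scope.
Local Open Scope ring_scope.

(* The Cartesian power A^m, as a subset of R^m; points of R^m are row vectors. *)
Definition set_power (R : realType) (A : set R) (m : nat) : set 'rV[R]_m :=
  [set x | forall i : 'I_m, A (x 0 i)].
Arguments set_power {R} A m.

Definition lin_form (R : realType) (m : nat) (a : m.-tuple R) (x : 'rV[R]_m) : R :=
  \sum_(i < m) tnth a i * x 0 i.

Lemma lin_form_is_linear (R : realType) (m : nat) (a : m.-tuple R) :
  linear (lin_form a : 'rV[R]_m -> R^o).
Proof.
move=> c x y; rewrite /lin_form scaler_sumr -big_split /=.
by apply: eq_bigr => i _; rewrite !mxE mulrDr mulrCA.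
Qed.

Definition frakI (R : realType) (phi : set R) (m : nat) (a : m.-tuple R) (r : R) :
    set R :=
  (lin_form a @` set_power phi m) `&` `]- r, r[%classic.

(* Main.v *)
(** In [v = \sum_i a_i phi_(k_i)], let [J] be the largest index that occurs and
    [c] the sum of the [a_i] with [k_i = J].  If [c = 0], these terms drop out
    and we descend to fewer terms.  If [c <> 0], then
    [|v| >= |c| phi_J - (\sum_i |a_i|) phi_(J-1)], which lacunarity makes larger
    than [r] once [J] is large, uniformly since [c] ranges over the finitely
    many subsums of [a].  So a value in [(-r, r)] is a subsum involving
    only [phi_j] with [j] bounded. *)
Require Import Defs.
From mathcomp Require Import all_boot all_order all_algebra.
From mathcomp Require Import all_classical all_reals all_analysis.
From mathcomp Require Import lra.
Import Order.TTheory GRing.Theory Num.Theory.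
Import numFieldNormedType.Exports.

Local Open Scope classical_set_scope.
Local Open Scope ring_scope.

Lemma lacunary_dominates (R : realType) (phi : nat -> R) (c s r : R) :
  increasing_seq phi -> (forall k, 0 < phi k) ->
  (fun k => phi k / phi k.+1) @ \oo --> (0 : R) ->
  0 < c -> 0 <= s -> 0 < r ->
  \forall k \near \oo, s * phi k + r < c * phi k.+1.
Proof.
move=> phi_incr phi_gt0 phi_lac c_gt0 s_ge0 r_gt0.
(* Since [phi 0 <= phi k], the constant [r] is at most [r / phi 0 * phi k]. Hence
   [s * phi k + r <= t * phi k], and a ratio below [c / t] suffices. *)
pose t := s + r / phi 0%N.
have t_gt0 : 0 < t by rewrite ltr_wpDl// divr_gt0.
have ct_gt0 : 0 < c / t by rewrite divr_gt0.
near=> k.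
have : `|phi k / phi k.+1| < c / t.
  near: k.
  by move/cvgr0Pnorm_lt : phi_lac; apply.
rewrite ger0_norm ?divr_ge0 ?ltW// ltr_pdivrMr// mulrAC ltr_pdivlMr//.
apply: le_lt_trans; rewrite [leRHS]mulrC /t mulrDl lerD2l mulrAC.
by rewrite ler_pdivlMr// ler_pM2l.
Unshelve. all: by end_near.
Qed.

(** Strong induction on the size of [A]: [B] arises by deleting cancelling top blocks, so [k] never
    changes. *)
Lemma subsum_of_small_indices (R : realType) (phi : nat -> R) (I : finType)
    (a : I -> R) (r : R) (N : nat) (k : I -> nat) (A : {set I}) :
  increasing_seq phi -> (forall j, 0 < phi j) ->
  (forall (B : {set I}) (j : nat), (N <= j)%N -> \sum_(i in B) a i != 0 ->
    (\sum_i `|a i|) * phi j + r < `|\sum_(i in B) a i| * phi j.+1) ->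
  `|\sum_(i in A) a i * phi (k i)| < r ->
  exists2 B : {set I}, (forall i, i \in B -> (k i <= N)%N) &
    \sum_(i in A) a i * phi (k i) = \sum_(i in B) a i * phi (k i).
Proof.
move=> phi_incr phi_gt0 dom.
have [n] := ubnP #|A|; elim: n A => // n IHn A cardA ltr.
have [/forall_inP smallA|] := boolP [forall i in A, k i <= N]%N.
  by exists A.
case/forall_inPn => i0 Ai0; rewrite -ltnNge => ltNi0.
case: (@arg_maxnP _ i0 [in A] k Ai0) => i1 /= Ai1 maxi1.
pose B := [set i in A | k i == k i1].
have sumE : \sum_(i in A) a i * phi (k i) =
    (\sum_(i in B) a i) * phi (k i1) + \sum_(i in A :\: B) a i * phi (k i).
  rewrite (big_setID B)/=; congr (_ + _).
  have -> : A :&: B = B.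
    by apply/finset.setIidPr/fintype.subsetP => i; rewrite inE => /andP[].
  by rewrite mulr_suml; apply: eq_bigr => i; rewrite inE => /andP[_ /eqP ->].
(* A cancelling block leaves the value unchanged, and removing it shrinks [A] strictly because it
   contains [i1]. *)
have [c0|c_neq0] := eqVneq (\sum_(i in B) a i) 0.
  move: ltr; rewrite sumE c0 mul0r add0r; apply: IHn.
  rewrite ltnS in cardA; apply: leq_trans cardA.
  apply/proper_card/fintype.properP.
  split; first exact: finset.subsetDl.
  by exists i1; rewrite // !inE Ai1 eqxx.
have ltNi1 : (N < k i1)%N by exact: leq_trans ltNi0 (maxi1 _ Ai0).
(* As [N < k i1], the predecessor is a true one and is at least [N], so [dom] applies there. *)
have ki1E : k i1 = (k i1).-1.+1 by rewrite (ltn_predK ltNi1).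
have := dom B (k i1).-1 _ c_neq0; rewrite -ki1E -ltnS -ki1E => /(_ ltNi1).
(* With this bound, [dom] and the triangle inequality contradict [ltr]. *)
suff : `|\sum_(i in A :\: B) a i * phi (k i)| <=
    (\sum_i `|a i|) * phi (k i1).-1.
  move: ltr; rewrite sumE.
  set c := \sum_(i in B) a i; set rest := \sum_(i in _) _ => ltr.
  have : `|c| * phi (k i1) <= `|c * phi (k i1) + rest| + `|rest|.
    rewrite -[X in _ * X]gtr0_norm// -normrM -[X in `|X| <= _](addrK rest).
    exact: ler_normB.
  lra.
rewrite mulr_suml (le_trans (ler_norm_sum _ _ _))//.
rewrite [leRHS](bigID (mem (A :\: B)))/= ler_wpDr//.
  by apply: sumr_ge0 => i _; rewrite mulr_ge0// ltW.
apply: ler_sum => i; rewrite !inE => /andP[kiB Ai].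
(* Outside the top block [k i < k i1], hence [k i <= (k i1).-1]. *)
rewrite normrM ler_wpM2l// gtr0_norm// phi_incr -ltnS -ki1E.
move: kiB; rewrite Ai/= => kiB.
by rewrite ltn_neqAle kiB; exact: maxi1.
Qed.

Theorem propositionA1 (R : realType) (phi_ : nat -> R)
    (phi_increasing : increasing_seq phi_)
    (phi_gt0 : forall k : nat, 0 < phi_ k)
    (phi_lacunary : (fun k : nat => phi_ k / phi_ k.+1) @ \oo --> (0 : R))
    (m : nat) (m_gt0 : (0 < m)%N) (a : m.-tuple R) (r : R) (r_gt0 : 0 < r) :
  finite_set (frakI (range phi_) a r).
Proof.
have : \forall j \near \oo, forall B : {set 'I_m},
    \sum_(i in B) tnth a i != 0 ->
    (\sum_i `|tnth a i|) * phi_ j + r <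
    `|\sum_(i in B) tnth a i| * phi_ j.+1.
  (* There are finitely many [B], so one threshold serves all of them. *)
  apply: filter_forall => B.
  have [->|c_neq0] := eqVneq (\sum_(i in B) tnth a i) 0; first exact: nearW.
  have : 0 < `|\sum_(i in B) tnth a i| by rewrite normr_gt0.
  move/(lacunary_dominates _ _ _ _ _ phi_increasing phi_gt0 phi_lacunary).
  move/(_ (\sum_i `|tnth a i|) r (sumr_ge0 _ _) r_gt0) => dom.
  by near=> j => _; near: j; apply: dom.
case=> N _ dom.
apply: (@sub_finite_set _ _ ((fun p : {set 'I_m} * {ffun 'I_m -> 'I_N.+1} =>
    \sum_(i in p.1) tnth a i * phi_ (p.2 i)) @` setT)); last first.
  exact/finite_image/finite_finset.
move=> _ [[x xphi <-]]; rewrite /= in_itv/= -ltr_norml.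
have xE i : exists j, phi_ j = x 0 i by have [j _ jE] := xphi i; exists j.
have [k kE] := boolp.choice xE.
have -> : lin_form a x = \sum_(i in [set: 'I_m]%SET) tnth a i * phi_ (k i).
  by apply: eq_big => [i|i _]; rewrite ?inE ?kE.
case/(@subsum_of_small_indices _ _ _ _ _ N) => //.
  by move=> B j leNj; exact: dom.
(* For [i] outside [B], [k i] may exceed [N] and [inord] then gives a default value, but such [i] do
   not enter the sum. *)
move=> B kB ->; exists (B, [ffun i => inord (k i)]) => //=.
by apply: eq_bigr => i iB; rewrite ffunE inordK// ltnS kB.
Unshelve. all: by end_near.
Qed.
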